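(* Let $d\ge 2$ and let $G$ be a $d$-regular graph of girth $g(G)\ge 6$. Then $G$ realizes the sequence $(2,1^d)$, i.e. the sequence of length $d+1$ whose first term is $2$ and whose remaining $d$ terms are $1$.
   Context: Graphs are finite, simple and connected. The girth $g(G)$ is the length of a shortest cycle of $G$. Given a proper coloring of $G$, a vertex $v$ is a color-dominating vertex (CDV) if its closed neighborhood $N[v]$ contains all colors used in the coloring. A b-coloring is a proper coloring in which every color class contains at least one CDV. $G$ realizes a finite non-increasing sequence $(s_1,\dots,s_k)$ of positive integers if $G$ has a b-coloring with exactly $k$ colors in which, for each $i\in\{1,\dots,k\}$, the $i$th color class contains at least $s_i$ CDVs. *)

(* Defs.v *)
From mathcomp Require Import all_boot.

Set Implicit Arguments.
Unset Strict Implicit.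
Unset Printing Implicit Defensive.

Section Graph.

Variables (T : finType) (e : rel T).

Definition nbhd (v : T) : {set T} := [set w | e v w].

Definition closed_nbhd (v : T) : {set T} := v |: nbhd v.

Definition connected_graph : Prop :=
  0 < #|T| /\ forall x y : T, connect e x y.

Definition regular (d : nat) : Prop := forall v : T, #|nbhd v| = d.

(* [ucycle] also accepts the empty sequence and, when [e] is symmetric, a
   single edge traversed back and forth; the size condition excludes both. *)
Definition graph_cycle (c : seq T) : Prop := ucycle e c /\ 2 < size c.

(* No [g] satisfies this when the graph is acyclic (infinite girth). *)
Definition is_girth (g : nat) : Prop :=
  (exists2 c : seq T, graph_cycle c & size c = g) /\
  (forall c : seq T, graph_cycle c -> g <= size c).

Section Coloring.

Variables (C : finType) (f : T -> C).

Definition proper_coloring : Prop := forall x y : T, e x y -> f x <> f y.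

Definition used_colors : {set C} := f @: [set: T].

Definition color_dominating (v : T) : bool :=
  used_colors \subset f @: closed_nbhd v.

Definition cdvs (c : C) : {set T} := [set v | f v == c & color_dominating v].

Definition b_coloring : Prop :=
  proper_coloring /\
  (forall c : C, c \in used_colors -> exists v : T, v \in cdvs c).

End Coloring.

(* Meant for non-increasing sequences of positive integers; positions in [s]
   are numbered from 0. *)
Definition realizes (s : seq nat) : Prop :=
  exists f : {ffun T -> 'I_(size s)},
    [/\ b_coloring f,
        #|used_colors f| = size s &
        forall i : 'I_(size s), nth 0 s i <= #|cdvs f i|].

End Graph.

(* Main.v *)
Require Import Defs.
From mathcomp Require Import all_boot.

(** A proper coloring of part of a [d]-regular graph extends greedily to the
    whole graph with [d + 1] colors, so it suffices to color a small region in
    which the required CDVs are already dominating.  Fix a vertex [v] and use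
    the closed neighborhood [N[v]] itself as the set of colors, each vertex of
    [N[v]] being colored by itself.  For each neighbor [u] of [v], color
    [N(u) \ v] bijectively by [N(v) \ u]: girth at least 6 makes the second
    neighborhood of [v] independent, so this is proper and every vertex of
    [N[v]] is a CDV.  For the extra CDV take a neighbor [u1] of [v] and [x] in
    [N(u1) \ v], let [u2] be the color of [x], and color [Y = N(x) \ u1]
    bijectively by [N[v] \ {u1, u2}].  A vertex of [Y] has at most one neighbor
    in each [N(u)], so the bijection [N(u) \ v -> N(v) \ u] only has to avoid,
    for each color, at most one vertex; this is possible because the color [u1]
    does not occur on [Y].  Then [x] and [u2] are two CDVs of color [u2]. *)

Set Implicit Arguments.
Unset Strict Implicit.
Unset Printing Implicit Defensive.

(** * Surjections between finite sets of equal size *)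

(* A free element [b0] is kept for the last step: every other [b] is forbidden
   for at most one [a], so two remaining candidates are enough to place it. *)
Lemma avoiding_surjection (T1 T2 : finType) (R : T1 -> T2 -> bool)
    (A : {set T1}) (B : {set T2}) (b0 : T2) :
  #|A| = #|B| -> b0 \in B ->
  (forall a, a \in A -> ~~ R a b0) ->
  (forall a a' b, a \in A -> a' \in A -> b \in B ->
     R a b -> R a' b -> a = a') ->
  exists h : T1 -> T2, h @: A = B /\ forall a, a \in A -> ~~ R a (h a).
Proof.
move En: #|A| => n; elim: n A B En => [|n IH] A B cA cB b0B free Rinj.
  by move: b0B; rewrite (cards0_eq (esym cB)) inE.
have [B1|/set0Pn[b]] := eqVneq (B :\ b0) set0.
  have defB : B = [set b0] by rewrite -(setD1K b0B) B1 setU0.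
  have /cards1P[a defA] : #|A| == 1 by rewrite cA cB defB cards1.
  exists (fun=> b0); split; last exact: free.
  by rewrite defA imset_set1 defB.
rewrite !inE => /andP[bb0 bB].
have [a aA nRab] : exists2 a, a \in A & ~~ R a b.
  have : 1 < #|A| by rewrite cA cB (cardsD1 b0) b0B (cardsD1 b) !inE bb0 bB.
  case/card_gt1P => a [a' [aA a'A aa']].
  have [Rab|] := boolP (R a b); last by exists a.
  exists a' => //; apply/negP => Ra'b.
  by case/eqP: aa'; apply: Rinj Rab Ra'b.
have [h [hB hR]] : exists h : T1 -> T2,
    h @: (A :\ a) = B :\ b /\ forall c, c \in A :\ a -> ~~ R c (h c).
  apply: IH.
  - by move: cA; rewrite (cardsD1 a) aA => -[].
  - by move: cB; rewrite (cardsD1 b B) bB => -[].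
  - by rewrite !inE eq_sym bb0.
  - by move=> c /setD1P[_ /free].
  - move=> c c' b' /setD1P[_ cA'] /setD1P[_ c'A] /setD1P[_ b'B].
    exact: Rinj.
exists (fun c => if c == a then b else h c); split=> [|c cA'].
  rewrite -(setD1K aA) imsetU1 eqxx -[RHS](setD1K bB) -hB; congr (_ |: _).
  by apply: eq_in_imset => c /setD1P[/negPf->].
by case: eqP => [->//|/eqP ca]; apply: hR; rewrite !inE ca.
Qed.

Lemma card_surjection (T1 T2 : finType) (A : {set T1}) (B : {set T2}) :
  #|A| = #|B| -> 0 < #|B| -> exists h : T1 -> T2, h @: A = B.
Proof.
move=> cAB /card_gt0P[b bB].
have [//|//|h [hAB _]] :=
  @avoiding_surjection _ _ (fun _ _ => false) A B b cAB bB.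
by exists h.
Qed.

Lemma injective_of_card_imset (T1 T2 : finType) (h : T1 -> T2)
    (A : {set T1}) (B : {set T2}) :
  h @: A = B -> #|A| = #|B| -> {in A &, injective h}.
Proof. by move=> hAB cAB; apply/imset_injP; rewrite hAB cAB. Qed.

(** * Extending and relabeling colorings *)

(** Induction on the number of vertices outside [S]: such a vertex has fewer than [#|K|] neighbors,
    so some color of [K] is missing among the values of [f] on its neighborhood. The values at
    neighbors outside [S] are avoided too, which the degree bound allows. *)
Lemma greedy_extension (T : finType) (e : rel T) (C : finType)
    (K : {set C}) (S : {set T}) (f : T -> C) :
  symmetric e -> irreflexive e -> (forall v, #|nbhd e v| < #|K|) ->
  (forall x, x \in S -> f x \in K) ->
  (forall x y, x \in S -> y \in S -> e x y -> f x <> f y) ->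
  exists g : T -> C, [/\ {in S, g =1 f}, forall x, g x \in K
                       & proper_coloring e g].
Proof.
move=> es ei degK; move En: #|~: S| => n.
elim: n S f En => [|n IH] S f cS fK fP.
  have inS x : x \in S by move/cards0_eq/setP/(_ x): cS; rewrite !inE => /negbFE.
  by exists f; split=> // [x|x y]; [apply: fK | apply: fP].
have /card_gt0P[w] : 0 < #|~: S| by rewrite cS.
rewrite inE => wS.
have [c cK cN] : exists2 c, c \in K & c \notin f @: nbhd e w.
  have : ~~ (K \subset f @: nbhd e w).
    apply/negP => /subset_leq_card; rewrite leqNgt => /negP; apply.
    exact: leq_ltn_trans (leq_imset_card _ _) (degK w).
  by case/subsetPn => c; exists c.
have fresh y : e w y -> f y <> c.
  by move=> ewy fy; case/negP: cN; rewrite -fy; apply: imset_f; rewrite inE.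
pose f' x := if x == w then c else f x.
have [|x|x y|g [gf' gK gP]] := IH (w |: S) f'.
- move: cS; rewrite (cardsD1 w) inE wS => -[<-].
  by apply: eq_card => x; rewrite !inE negb_or.
- by rewrite /f' !inE; case: eqP => //= _ /fK.
- rewrite /f' !inE; case: eqP => [->|_]; case: eqP => [->|_] //=.
  + by rewrite ei.
  + by move=> _ _ /fresh fy /esym.
  + by rewrite es => _ _ /fresh.
  + exact: fP.
exists g; split=> // x xS; rewrite gf' ?inE ?xS ?orbT // /f'.
by case: eqP xS wS => // -> ->.
Qed.

(* The colors of [g] are vertices; they are relabeled so that [c0] gets index
   0, the position of the term 2 of the sequence. *)
Lemma realizes_of_coloring (T : finType) (e : rel T) (d : nat)
    (K : {set T}) (g : T -> T) (c0 w1 w2 : T) :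
  0 < d -> #|K| = d.+1 -> c0 \in K ->
  (forall x, g x \in K) -> proper_coloring e g ->
  (forall c, c \in K -> exists2 w, g w = c & K \subset g @: closed_nbhd e w) ->
  w1 != w2 -> g w1 = c0 -> g w2 = c0 ->
  K \subset g @: closed_nbhd e w1 -> K \subset g @: closed_nbhd e w2 ->
  realizes e (2 :: nseq d 1).
Proof.
move=> d0 cK c0K gK gP dom w12 gw1 gw2 dom1 dom2; rewrite /realizes.
pose i0 : 'I_(size (2 :: nseq d 1)) := ord0.
have cI : #|[set: 'I_(size (2 :: nseq d 1))] :\ i0| = d.
  have : #|[set: 'I_(size (2 :: nseq d 1))]| = d.+1.
    by rewrite cardsT card_ord /= size_nseq.
  by rewrite (cardsD1 i0) inE => -[].
have [||h hK] := @card_surjection _ _ (K :\ c0) (setT :\ i0).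
- by rewrite cI; move: cK; rewrite (cardsD1 c0) c0K => -[].
- by rewrite cI.
pose p c := if c == c0 then i0 else h c.
have pK : p @: K = setT.
  rewrite -(setD1K c0K) imsetU1 {1}/p eqxx -[RHS](setD1K (in_setT i0)) -hK.
  by congr (_ |: _); apply: eq_in_imset => c /setD1P[/negPf]; rewrite /p => ->.
have pI : {in K &, injective p}.
  by apply: (injective_of_card_imset pK); rewrite cardsT card_ord /= size_nseq.
pose f := [ffun x => p (g x)].
have domf w : K \subset g @: closed_nbhd e w -> color_dominating e f w.
  move=> /(imsetS p); rewrite pK -imset_comp => sub.
  apply: subset_trans (subsetT _) (subset_trans sub _).
  by apply/subsetP => _ /imsetP[z zN ->]; apply/imsetP; exists z; rewrite ?ffunE.
have cdv i : exists w, w \in cdvs e f i.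
  have : i \in p @: K by rewrite pK.
  case/imsetP => c /dom[w gw /domf wdom] ->.
  by exists w; rewrite inE ffunE gw eqxx.
exists f; split.
- split=> [x y exy|i _]; last exact: cdv.
  by rewrite !ffunE => /(pI _ _ (gK x) (gK y)); apply: gP.
(* Every index has a CDV, hence is used. *)
- rewrite -[RHS]card_ord -cardsT; congr #|pred_of_set _|; apply/setP => i.
  rewrite inE; have [w] := cdv i; rewrite inE => /andP[/eqP <- _].
  exact: imset_f.
- move=> i; have [->|ii0] := eqVneq i i0.
    have <- : #|[set w1; w2]| = 2 by rewrite cards2 w12.
    apply/subset_leq_card/subsetP => w; rewrite !inE ffunE.
    by case/orP => /eqP->; rewrite ?gw1 ?gw2 /p eqxx domf.
  have -> : nth 0 (2 :: nseq d 1) i = 1.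
    case: i ii0 => [[|j] ltj] //= _.
    by rewrite nth_nseq; move: ltj; rewrite /= size_nseq ltnS => ->.
  by apply/card_gt0P.
Qed.

(** * Short closed walks in girth at least 6 *)

Section Girth.

Variables (T : finType) (e : rel T).
Hypotheses (e_sym : symmetric e) (e_irr : irreflexive e).
Variable g : nat.
Hypotheses (e_girth : is_girth e g) (g_ge6 : 6 <= g).

Lemma short_cycle (c : seq T) :
  cycle e c -> uniq c -> 2 < size c -> size c < 6 -> False.
Proof.
move=> cc uc c2 c6; case: e_girth => _ /(_ c) gc.
have /gc : graph_cycle e c by split=> //; rewrite /ucycle cc.
by move/(leq_trans g_ge6); rewrite leqNgt c6.
Qed.

Lemma edge_neq a b : e a b -> a != b.
Proof. by apply: contraTneq => ->; rewrite e_irr. Qed.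

Lemma no_triangle a b c : e a b -> e b c -> e c a -> False.
Proof.
move=> ab bc ca; apply: (@short_cycle [:: a; b; c]) => //=.
  by rewrite ab bc ca.
by rewrite !inE negb_or (edge_neq ab) (edge_neq bc) eq_sym (edge_neq ca).
Qed.

Lemma no_square a b c x : e a b -> e b c -> e c x -> e x a ->
  a != c -> b != x -> False.
Proof.
move=> ab bc cx xa ac bx; apply: (@short_cycle [:: a; b; c; x]) => //=.
  by rewrite ab bc cx xa.
rewrite !inE !negb_or (edge_neq ab) (edge_neq bc) (edge_neq cx) ac bx.
by rewrite eq_sym (edge_neq xa).
Qed.

(** If two nonconsecutive vertices of the closed walk coincide, a triangle remains; otherwise the
    walk is a cycle of length 5. *)
Lemma no_pentagon a b c x y :
  e a b -> e b c -> e c x -> e x y -> e y a -> False.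
Proof.
move=> ab bc cx xy ya.
have [E|ac] := eqVneq a c; first by rewrite -E in cx; apply: no_triangle cx xy ya.
have [E|bx] := eqVneq b x; first by rewrite -E in xy; apply: no_triangle xy ya ab.
have [E|cy] := eqVneq c y; first by rewrite -E in ya; apply: no_triangle ab bc ya.
have [E|ax] := eqVneq a x; first by rewrite -E in cx; apply: no_triangle ab bc cx.
have [E|yb] := eqVneq y b; first by rewrite E in xy; apply: no_triangle bc cx xy.
apply: (@short_cycle [:: a; b; c; x; y]) => //=; first by rewrite ab bc cx xy ya.
rewrite !inE !negb_or (edge_neq ab) (edge_neq bc) (edge_neq cx) (edge_neq xy).
by rewrite ac bx cy ax (eq_sym b) yb eq_sym (edge_neq ya).
Qed.

End Girth.

(** * The coloring around [v] *)

Theorem theorem5p1 (T : finType) (e : rel T)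
    (e_sym : symmetric e) (e_irr : irreflexive e)
    (e_conn : connected_graph e)
    (d : nat) (d_ge2 : 2 <= d) (e_reg : regular e d)
    (g : nat) (e_girth : is_girth e g) (g_ge6 : 6 <= g) :
  realizes e (2 :: nseq d 1).
Proof.
have tri := no_triangle e_irr e_girth g_ge6.
have sq := no_square e_irr e_girth g_ge6.
have pent := no_pentagon e_irr e_girth g_ge6.
have d_gt0 : 0 < d by apply: ltnW.
(* Here [2 <= d] enters: it gives [u1] a neighbor [x] other than [v]. *)
have d1_gt0 : 0 < d.-1 by rewrite -ltnS prednK.
have cN a b : e a b -> #|nbhd e a :\ b| = d.-1.
  by move=> ab; rewrite -(e_reg a) (cardsD1 b (nbhd e a)) inE ab.
have [/card_gt0P[v _] _] := e_conn.
have /card_gt0P[u1] : 0 < #|nbhd e v| by rewrite e_reg.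
rewrite inE => vu1; have u1v : e u1 v by rewrite e_sym.
have /card_gt0P[x] : 0 < #|nbhd e u1 :\ v| by rewrite cN.
rewrite !inE => /andP[xv u1x]; have xu1 : e x u1 by rewrite e_sym.
(* The coloring of [N(u1) \ v] is fixed first, since it determines [u2] and thereby the colors
   available for [Y]. *)
have [||h1 h1E] := @card_surjection _ _ (nbhd e u1 :\ v) (nbhd e v :\ u1);
  rewrite ?cN //.
pose u2 := h1 x.
have : u2 \in nbhd e v :\ u1 by rewrite -h1E imset_f // !inE xv.
rewrite !inE => /andP[u21 vu2].
pose K := closed_nbhd e v.
have vK : v \in K by rewrite !inE eqxx.
have cK : #|K| = d.+1 by rewrite cardsU1 e_reg inE e_irr.
pose Y := nbhd e x :\ u1.
have cY : #|Y| = d.-1 by apply: cN.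
have cC : #|K :\ u1 :\ u2| = d.-1.
  move: cK; rewrite (cardsD1 u1) (cardsD1 u2) !inE u21 vu1 vu2 !orbT.
  by move=> /= [<-].
have [||psi psiE] := @card_surjection _ _ Y (K :\ u1 :\ u2); rewrite ?cC //.
have psiI : {in Y &, injective psi}.
  by apply: (injective_of_card_imset psiE); rewrite cY cC.
have psiP y : y \in Y -> [/\ psi y != u2, psi y != u1 & psi y \in K].
  move=> yY; have : psi y \in K :\ u1 :\ u2 by rewrite -psiE imset_f.
  by rewrite !in_setD1 => /and3P[].
have YP y : y \in Y -> [/\ y != u1, e x y & e y x].
  by rewrite !inE => /andP[-> xy]; split=> //; rewrite e_sym.
(* With [YK] below, this places [Y] at distance 3 from [v]. *)
have Ynadj y u : y \in Y -> e v u -> e y u -> False.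
  by move=> /YP[_ _ yx] vu yu; apply: (pent v u y x u1) => //; rewrite e_sym.
have YK y : y \in Y -> y \notin K.
  move=> yY; apply/negP; rewrite !inE => /orP[/eqP yv|vy].
    have [_ xy _] := YP y yY; apply: (tri v u1 x) => //.
    by rewrite -yv.
  have [yu1 xy yx] := YP y yY.
  by apply: (sq v u1 x y) => //; rewrite ?(e_sym y) // eq_sym.
have /fin_all_exists[h hP] : forall u, exists h : T -> T, e v u ->
    [/\ h @: (nbhd e u :\ v) = nbhd e v :\ u,
        forall z y, z \in nbhd e u :\ v -> y \in Y -> e y z -> h z <> psi y
      & u = u1 -> h x = u2].
  (* For [u1] the map [h1] is kept: a vertex of [Y] has only [x] as a neighbor in [N(u1)], and the
     color [u2] of [x] does not occur on [Y]. *)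
  move=> u; have [->|uu1] := eqVneq u u1.
    exists h1 => _; split=> // z y /setD1P[zv]; rewrite inE => u1z yY yz.
    have [yu1 xy yx] := YP y yY.
    have [->|zx] := eqVneq z x.
      by have [+ _ _] := psiP y yY => /eqP nu2 /esym.
    exfalso; apply: (sq u1 z y x) => //; [by rewrite e_sym|by rewrite eq_sym].
  have [vu|_] := boolP (e v u); last by exists id.
  have uv : e u v by rewrite e_sym.
  (* [R z b] says that giving [z] the color [b] would clash with a neighbor in [Y]. As [psi] is
     injective on [Y], two vertices forbidden for the same color would share a neighbor in [Y],
     closing a square through [u]. *)
  pose R z b := [exists y in Y, e y z && (psi y == b)].
  have [||z zu|z z' b zu z'u _|h [hE hR]] :=
    @avoiding_surjection _ _ R (nbhd e u :\ v) (nbhd e v :\ u) u1.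
  - by rewrite !cN.
  - by rewrite !inE eq_sym uu1.
  - apply/existsP => -[y /and3P[yY _ /eqP psiy]].
    by have [_ /eqP] := psiP y yY.
  - move=> /existsP[y /and3P[yY yz /eqP psiy]].
    move=> /existsP[y' /and3P[y'Y y'z' /eqP psiy']].
    have yy' : y = y' by apply: psiI; rewrite ?psiy.
    rewrite -{}yy' in y'z'.
    move: zu z'u; rewrite !inE => /andP[_ uz] /andP[_ uz'].
    apply/eqP/negPn/negP => zz'.
    apply: (sq u z y z') => //; [by rewrite e_sym|by rewrite e_sym|].
    apply: contraNneq (YK y yY) => <-.
    by rewrite !inE vu orbT.
  exists h => _; split=> // [z y zu yY yz hz|E]; last by case/eqP: uu1.
  by case/existsP: (hR z zu); exists y; rewrite yY yz hz eqxx.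
(* On [N2] the default [v] is never taken, and the absence of squares makes the choice unique
   ([parentE]). *)
pose parent z := odflt v [pick u | e v u && e u z].
pose N2 := [set z | [exists u, e v u && e u z] && (z != v)].
have N2P z : z \in N2 -> [/\ e v (parent z), e (parent z) z & z != v].
  rewrite inE => /andP[/existsP[u uP] zv]; rewrite /parent.
  by case: pickP => [u' /andP[]//|/(_ u)]; rewrite uP.
have parentE u z : e v u -> z \in nbhd e u :\ v -> z \in N2 /\ parent z = u.
  move=> vu /setD1P[zv]; rewrite inE => uz.
  have zN2 : z \in N2.
    by rewrite inE zv andbT; apply/existsP; exists u; rewrite vu.
  split=> //; have [vp pz _] := N2P z zN2.
  apply/eqP/negPn/negP => pu.
  have [zu uv] : e z u /\ e u v by split; rewrite e_sym.
  by apply: (sq v (parent z) z u) => //; rewrite eq_sym.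
(* The sets [K], [Y] and [N2] are pairwise disjoint, so the order of the tests is immaterial; values
   outside [S] are discarded by the greedy extension. *)
pose f z := if z \in K then z else if z \in Y then psi z else h (parent z) z.
pose S := K :|: (Y :|: N2).
have KS : {subset K <= S} by move=> z zK; apply/setUP; left.
have YS : {subset Y <= S} by move=> z zY; apply/setUP; right; apply/setUP; left.
have NS : {subset N2 <= S} by move=> z zN; apply/setUP; right; apply/setUP; right.
have fK z : z \in K -> f z = z by rewrite /f => ->.
have fY y : y \in Y -> f y = psi y.
  by move=> yY; rewrite /f (negPf (YK y yY)) yY.
have fN2 z : z \in N2 -> f z = h (parent z) z.
  move=> zN2; have [vp pz zv] := N2P z zN2; rewrite /f !in_setU1 (negPf zv) inE.
  case: ifP => [vz|_]; first by case: (tri v (parent z) z); rewrite // e_sym.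
  case: ifP => // zY; case: (Ynadj z _ zY vp); by rewrite e_sym.
have hN2 z : z \in N2 -> h (parent z) z \in nbhd e v :\ parent z.
  move=> zN2; have [vp pz zv] := N2P z zN2.
  by have [<- _ _] := hP _ vp; rewrite imset_f // !inE zv.
have fS z : z \in S -> f z \in K.
  case/setUP=> [zK|/setUP[zY|zN2]]; first by rewrite fK.
    by rewrite fY //; have [] := psiP z zY.
  by rewrite fN2 //; have /setD1P[_] := hN2 z zN2; rewrite !inE orbC => ->.
have PKY a b : a \in K -> b \in Y -> e a b -> False.
  case/setU1P=> [->|+] bY ab; last first.
    by rewrite inE => va; apply: (Ynadj b a); rewrite // e_sym.
  by have := YK b bY; rewrite !inE ab orbT.
have PKK a b : a \in K -> b \in K -> e a b -> f a <> f b.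
  by move=> aK bK ab; rewrite !fK //; apply/eqP; exact: (edge_neq e_irr ab).
have PKN2 a b : a \in K -> b \in N2 -> e a b -> f a <> f b.
  move=> aK bN2 ab; rewrite fK // fN2 //.
  have := hN2 b bN2; rewrite !inE => /andP[hp vh].
  have [vp pb bv] := N2P b bN2.
  move: aK; rewrite !inE => /orP[/eqP->|va]; first exact/eqP/(edge_neq e_irr).
  have [_ pa] : b \in N2 /\ parent b = a by apply: parentE; rewrite ?inE ?bv.
  by move=> ah; rewrite -ah pa eqxx in hp.
have PYY a b : a \in Y -> b \in Y -> e a b -> f a <> f b.
  by move=> /YP[_ xa _] /YP[_ _ bx] ab; case: (tri x a b).
have PYN2 a b : a \in Y -> b \in N2 -> e a b -> f a <> f b.
  move=> aY bN2 ab; rewrite fY // fN2 //; have [vp pb bv] := N2P b bN2.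
  have [_ hpsi _] := hP _ vp.
  by apply/nesym/hpsi; rewrite // !inE bv.
(* The closed walk through [v] and both parents may be degenerate: [pent] also covers equal
   parents. *)
have PN2N2 a b : a \in N2 -> b \in N2 -> e a b -> f a <> f b.
  move=> /N2P[vp pa _] /N2P[vq qb _] ab.
  by case: (pent v (parent a) a b (parent b)); rewrite // e_sym.
have fP a b : a \in S -> b \in S -> e a b -> f a <> f b.
  move=> /setUP[aK|/setUP[aY|aN2]] /setUP[bK|/setUP[bY|bN2]] ab;
    have ba := ab; rewrite e_sym in ba.
  - exact: PKK.
  - by case: (PKY a b).
  - exact: PKN2.
  - by case: (PKY b a).
  - exact: PYY.
  - exact: PYN2.
  - exact/nesym/PKN2.
  - exact/nesym/PYN2.
  - exact: PN2N2.
have [|//|//|c [cf cK' cP]] := @greedy_extension _ e _ K S f e_sym e_irr.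
  by move=> w; rewrite cK e_reg.
have cKE w : w \in K -> c w = w by move=> wK; rewrite cf ?fK // KS.
have cYE w : w \in Y -> c w = psi w.
  by move=> wY; rewrite cf ?fY // YS.
have cN2E u w : e v u -> w \in nbhd e u :\ v -> c w = h u w.
  move=> vu wu; have [wN2 pw] := parentE u w vu wu.
  by rewrite cf ?fN2 ?pw // NS.
have domK w : w \in K -> K \subset c @: closed_nbhd e w.
  move=> wK; apply/subsetP => k kK; apply/imsetP.
  move: (wK); rewrite in_setU1 inE => /orP[/eqP->|vw].
    by exists k; rewrite ?cKE.
  have [kw|kw] := eqVneq k w; first by exists k; rewrite ?cKE // kw !inE eqxx.
  have [kv|kv] := eqVneq k v.
    by exists k; rewrite ?cKE // kv !inE e_sym vw orbT.
  (* The colors other than [v] and [w] are those that [h w] places on [N(w) \ v]. *)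
  have [hE _ _] := hP w vw.
  have : k \in nbhd e v :\ w by move: kK; rewrite !inE (negPf kv) kw.
  rewrite -hE => /imsetP[z zw ->]; exists z; last by rewrite (cN2E w).
  by move: zw; rewrite !inE => /andP[_ ->]; rewrite orbT.
have xu1N : x \in nbhd e u1 :\ v by rewrite !inE xv.
have cx : c x = u2 by rewrite (cN2E u1) //; have [_ _ ->] := hP u1 vu1.
have u2K : u2 \in K by rewrite !inE vu2 orbT.
have u1K : u1 \in K by rewrite !inE vu1 orbT.
(* The vertex [x] sees [u2] on itself, [u1] on [u1], and all other colors on [Y] through [psi]. *)
have domx : K \subset c @: closed_nbhd e x.
  apply/subsetP => k kK; apply/imsetP.
  have [->|k2] := eqVneq k u2; first by exists x; rewrite ?cx // !inE eqxx.
  have [->|k1] := eqVneq k u1.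
    by exists u1; rewrite ?cKE // !inE xu1 orbT.
  have : k \in K :\ u1 :\ u2 by rewrite 2!in_setD1 k2 k1.
  rewrite -psiE => /imsetP[y yY ->]; exists y; last by rewrite cYE.
  by have [_ xy _] := YP y yY; rewrite !inE xy orbT.
have u2x : u2 != x.
  by apply/eqP => E; rewrite -E in u1x; apply: (tri v u1 u2); rewrite // e_sym.
apply: (@realizes_of_coloring _ _ _ K c u2 u2 x) => //.
- by move=> w wK; exists w; [apply: cKE | apply: domK].
- exact: cKE.
- exact: domK.
Qed.
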